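(* Let $(X,d_X,\odot,0_X)$ be an editable space. Given two $X$-valued dendrograms $T$ and $T'$, $d_E(T,T')=0$ if and only if $T$ and $T'$ are equal up to degree $2$ vertices. In other words, $d_E$ is a metric for $X$-valued dendrograms considered up to degree $2$ vertices.
   Context: **Editable spaces.** An editable space is a set $X$ with a metric $d_X$, an operation $\odot$ and an element $0_X$ such that: (P1) $(X,d_X)$ is a metric space; (P2) $(X,\odot,0_X)$ is a commutative monoid; (P3) $d_X(0_X,x\odot y)=d_X(0_X,x)+d_X(0_X,y)$ for all $x,y$; (P4) $d_X(x,y)=d_X(z\odot x,z\odot y)=d_X(x\odot z,y\odot z)$ for all $x,y,z$. **Dendrograms.** A tree structure $T$ is a finite connected rooted acyclic graph $(V_T,E_T)$ with root $r_T$. The relation child $<$ parent generates a partial order on $V_T$. Each edge is written $(a,b)$ with $a<b$ ($b$ the parent of $a$) and is identified with its lower vertex $a$, so $E_T\cong V_T\setminus\{r_T\}$. A ''degree $2$ vertex'' is a non-root vertex with exactly one child. An ($X$-valued) dendrogram is a tree structure $T$ with a weight function $\varphi_T:E_T\to X\setminus\{0_X\}$. Dendrograms are considered up to isomorphism of rooted trees preserving weights. **Edits and costs.** - Shrinking an edge: replace its weight $x$ by another element $y\in X\setminus\{0_X\}$; cost $d_X(x,y)$. - Deleting an edge $(v_1,v_2)$ of weight $x$: remove $v_1$, its children becoming children of $v_2$ (keeping their weights); cost $d_X(x,0_X)$. Its inverse is the insertion of an edge of weight $x\in X\setminus\{0_X\}$ at a vertex $v$ (a new child of $v$ is created and any,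 possibly empty, subset of the children of $v$ becomes the set of its children); cost $d_X(x,0_X)$. - Ghosting a degree $2$ vertex $v$: remove $v$ and join its two adjacent edges, of weights $x,y$, into one edge of weight $x\odot y$; cost $0$. Its inverse is the splitting of an edge (of weight $x\odot y$ into two consecutive edges of weights $x,y\in X\setminus\{0_X\}$); cost $0$. A finite edit path from $T$ to $T'$ is a finite composition of edits transforming $T$ into (a dendrogram isomorphic to) $T'$; its cost is the sum of the costs of its edits; $\Gamma(T,T')$ is the set of such paths and $d_E(T,T')=\inf_{\gamma\in\Gamma(T,T')}cost(\gamma)$. **Equality up to degree $2$ vertices.** Two dendrograms are equal up to degree $2$ vertices if they become isomorphic (as dendrograms) after applying a finite number of ghostings or splittings. This is an equivalence relation. *)

(* Defs.v *)
From Stdlib Require Import Relation_Operators.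
From mathcomp Require Import all_boot all_order all_algebra.
From mathcomp Require Import all_classical all_reals all_analysis.

Set Implicit Arguments.
Unset Strict Implicit.
Unset Printing Implicit Defensive.

Import Order.TTheory GRing.Theory Num.Theory.

Local Open Scope classical_set_scope.
Local Open Scope ring_scope.

Definition is_metric (R : realType) (M : Type) (d : M -> M -> R) : Prop :=
  [/\ forall x y, 0 <= d x y,
      forall x y, d x y = 0 <-> x = y,
      forall x y, d x y = d y x &
      forall x y z, d x z <= d x y + d y z].

(** The monoid [(X, ⊙, 0_X)] is written additively, as an [nmodType]. *)
Record editableSpace (R : realType) := EditableSpace {
  carrier :> nmodType;
  dX : carrier -> carrier -> R;
  dX_metric : is_metric dX;
  dX0D : forall x y : carrier, dX 0 (x + y) = dX 0 x + dX 0 y;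
  dXDl : forall x y z : carrier, dX x y = dX (z + x) (z + y);
  dXDr : forall x y z : carrier, dX x y = dX (x + z) (y + z)
}.

Arguments dX {R e}.

(** A finite rooted tree is given by its parent map. The root is conventionally
    its own parent; that every vertex reaches the root by iterating [parent]
    expresses both connectedness and acyclicity. The edges are the pairs
    [(v, parent v)] with [v] not the root, and are identified with [v]. *)
Record tree := Tree {
  vertex :> finType;
  tree_root : vertex;
  parent : vertex -> vertex;
  parent_root : parent tree_root = tree_root;
  connect_root : forall v : vertex, fconnect parent v tree_root
}.

Arguments tree_root {t}.
Arguments parent {t}.

Definition children (T : tree) (v : T) : {set T} :=
  [set c : T | (c != tree_root) && (parent c == v)]%SET.

Definition tree_iso (T T' : tree) (f : T -> T') : Prop :=
  [/\ bijective f,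
      f tree_root = tree_root &
      forall x : T, f (parent x) = parent (f x)].

(** [T'] is [T] with the vertex [v] removed and the children of [v] attached to
    the parent of [v]; [f] embeds the vertices of [T'] into those of [T]. *)
Definition tree_remove (T : tree) (v : T) (T' : tree) (f : T' -> T) : Prop :=
  [/\ injective f,
      forall x : T, (x \in codom f) = (x != v),
      f tree_root = tree_root &
      forall x : T', f (parent x) =
        if parent (f x) == v then parent v else parent (f x)].

Section Dendrograms.
Context {R : realType}.

(** [weight v] is the weight of the edge [(v, parent v)]. There is no edge above
    the root, which conventionally carries the value [0]; since no edge has
    weight [0], the last field says nothing else than that weights lie in
    [X \ {0}]. *)
Record dendrogram (X : editableSpace R) := Dendrogram {
  shape :> tree;
  weight : shape -> X;
  weight_eq0 : forall v : shape, (weight v == 0) = (v == tree_root)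
}.

Context {X : editableSpace R}.
Implicit Types T S : dendrogram X.

Definition dendrogram_iso T T' : Prop :=
  exists2 f : T -> T', tree_iso f & forall x : T, weight (f x) = weight x.

(** The edits are relations: [T'] is, up to isomorphism, the result of applying
    the edit to [T]. *)
Definition shrinking T (v : T) (y : X) T' : Prop :=
  [/\ v != tree_root, y != 0 &
      exists2 f : T -> T', tree_iso f &
        forall x : T, weight (f x) = if x == v then y else weight x].

Definition deletion T (v : T) T' : Prop :=
  v != tree_root /\
  exists2 f : T' -> T, tree_remove v f & forall x : T', weight x = weight (f x).

Definition degree2 T (v : T) : Prop := v != tree_root /\ #|children v| = 1%N.

Definition ghosting T (v : T) T' : Prop :=
  degree2 v /\
  exists2 f : T' -> T, tree_remove v f &
    forall x : T', weight x =
      if parent (f x) == v then weight (f x) + weight v else weight (f x).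

(** [edit T T' c]: [T'] is obtained from [T] by one edit of cost [c]. *)
Inductive edit T T' : R -> Prop :=
| edit_shrink (v : T) (y : X) of shrinking v y T' :
    edit T T' (dX (weight v) y)
| edit_delete (v : T) of deletion v T' : edit T T' (dX (weight v) 0)
| edit_insert (v : T') of deletion v T : edit T T' (dX (weight v) 0)
| edit_ghost (v : T) of ghosting v T' : edit T T' 0
| edit_split (v : T') of ghosting v T : edit T T' 0.

(** [edit_path T T' c]: some finite edit path from [T] to [T'] has cost [c]. *)
Inductive edit_path T T' : R -> Prop :=
| edit_path_nil of dendrogram_iso T T' : edit_path T T' 0
| edit_path_cons S (c c' : R) of edit T S c & edit_path S T' c' :
    edit_path T T' (c + c').

Definition dE T T' : \bar R := ereal_inf [set c%:E | c in edit_path T T'].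

Definition ghost_or_split T T' : Prop :=
  (exists v : T, ghosting v T') \/ (exists v : T', ghosting v T).

Definition eq_deg2 T T' : Prop :=
  exists S S', [/\ clos_refl_trans _ ghost_or_split T S,
                   clos_refl_trans _ ghost_or_split T' S' &
                   dendrogram_iso S S'].

End Dendrograms.

Section Quotient.
Context {R : realType} (X : editableSpace R).

(** Dendrograms up to degree 2 vertices: the classes of [eq_deg2]. *)
Definition dendrogram_deg2 : Type :=
  {C : dendrogram X -> Prop | exists T : dendrogram X, C = eq_deg2 T}.

Definition deg2_class (T : dendrogram X) : dendrogram_deg2 :=
  exist _ (eq_deg2 T) (ex_intro _ T erefl).

End Quotient.

(* Main.v *)
Require Import Defs.
From Stdlib Require Import Relation_Operators.
From mathcomp Require Import all_boot all_order all_algebra.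
From mathcomp Require Import all_classical all_reals all_analysis.
From mathcomp Require Import lra.

Set Implicit Arguments.
Unset Strict Implicit.
Unset Printing Implicit Defensive.

Import Order.TTheory GRing.Theory Num.Theory.

Local Open Scope ring_scope.

(** Deletions and ghostings shrink a tree; call them reductions. Every edit is
    a reduction, the inverse of a reduction, or a shrinking, and a shrinking is
    an instance of a coarser relation: [close T S c], a tree isomorphism that
    changes the weights by at most [c] in total. The key fact is that an edit
    path can be rearranged, at no extra cost, into reductions of [T], then one
    change of weights, then inverse reductions leading to [T'] ([matched],
    [edit_path_matched]). As in a proof of confluence, this follows from two
    local facts.
    - A reduction of [T] can be mirrored in any [S] close to [T]
      ([close_reduction]): the triangle inequality pays for a deletion whose
      edge changed weight, translation invariance pays for a ghosting.
    - Two reductions of the same tree can be completed by at most one reduction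
      on each side to trees that are close, at the same total cost
      ([local_peak]). They commute, except when one ghosts a vertex [v] and the
      other deletes [v] or the only child of [v]; then the two results already
      have the same shape, and are as close as the deletion is expensive.

    As long as only ghostings occur, the weights stay in a finite set of sums of
    weights of [T] and [T'] ([sums]). Let [e] be the smallest distance between
    two distinct elements of this set, which contains [0]. A rearranged path of
    cost less than [e] cannot afford a first deletion, so all its reductions are
    ghostings, and then its change of weights is no change at all: [T] and [T']
    are equal up to degree 2 vertices ([cheap_path_eq_deg2]). An infimum equal
    to [0] supplies such a path.

    The metric on classes is then formal. Edit paths can be reversed and
    concatenated, every tree can be deleted down to its root, so [dE] is a
    finite pseudometric, and its kernel is [eq_deg2]. *)

(** * Rooted trees and the removal of a vertex *)

Section Trees.
Implicit Types T : tree.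

Lemma reaches_root T (v : T) : exists n, iter n parent v = tree_root.
Proof. by eexists; exact: iter_findex (Defs.connect_root v). Qed.

Lemma parent_neq T (v : T) : v != tree_root -> parent v != v.
Proof.
move=> vr; apply: contra vr => /eqP pv.
have [n <-] := reaches_root v.
by elim: n => //= n /eqP <-; rewrite pv.
Qed.

(** [parent] has no cycle of length 2: iterating it from such a cycle would
    never leave the cycle, hence never reach the root. *)
Lemma grandparent_neq T (v : T) : v != tree_root -> parent (parent v) != v.
Proof.
move=> vr; apply/negP => /eqP ppv.
have [n] := reaches_root v.
have: (iter n parent v == v) || (iter n parent v == parent v).
  elim: n => [|n /orP[]/eqP /= ->]; rewrite ?ppv ?eqxx ?orbT //.
move=> /orP[]/eqP -> e; first by rewrite e eqxx in vr.
by move: ppv vr; rewrite e parent_root => ->; rewrite eqxx.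
Qed.

Lemma tree_iso_refl T : tree_iso (@id T).
Proof. by split=> //; exists id. Qed.

Lemma tree_iso_comp (A B C : tree) (f : A -> B) (g : B -> C) :
  tree_iso f -> tree_iso g -> tree_iso (g \o f).
Proof.
move=> [bf rf pf] [bg rg pg]; split; first exact: bij_comp.
  by rewrite /= rf.
by move=> x /=; rewrite pf pg.
Qed.

Lemma tree_iso_inv (A B : tree) (f : A -> B) :
  tree_iso f -> exists g, [/\ tree_iso g, cancel f g & cancel g f].
Proof.
move=> [[g fg gf] rf pf]; exists g; split=> //; split.
- by exists f.
- by rewrite -rf fg.
- by move=> x; rewrite -{1}(gf x) -pf fg.
Qed.

Lemma tree_iso_root (A B : tree) (f : A -> B) (x : A) : tree_iso f ->
  (f x == tree_root) = (x == tree_root).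
Proof. by move=> [/bij_inj fi rf _]; rewrite -rf (inj_eq fi). Qed.

Lemma tree_remove_root (A B : tree) (v : A) (f : B -> A) (x : B) :
  tree_remove v f -> (f x == tree_root) = (x == tree_root).
Proof. by move=> [fi _ rf _]; rewrite -rf (inj_eq fi). Qed.

Lemma tree_remove_neq (A B : tree) (v : A) (f : B -> A) (x : B) :
  tree_remove v f -> f x != v.
Proof. by move=> [_ cf _ _]; rewrite -cf codom_f. Qed.

(** The form in which surjectivity of [f] onto the complement of [v] is used:
    maps avoiding [v] factor through [f]. *)
Lemma tree_remove_lift (A B : tree) (v : A) (f : B -> A) (I : Type)
    (g : I -> A) : tree_remove v f -> (forall i, g i != v) ->
  exists h : I -> B, forall i, f (h i) = g i.
Proof.
move=> [_ cf _ _] gv.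
have gc i : g i \in codom f by rewrite cf.
by exists (fun i => iinv (gc i)) => i; rewrite f_iinv.
Qed.

Lemma tree_remove_iso (A B C : tree) (v : A) (f : B -> A) (i : C -> B) :
  tree_remove v f -> tree_iso i -> tree_remove v (f \o i).
Proof.
move=> [fi cf rf pf] [[j ij ji] ri pi]; split.
- exact: inj_comp fi (can_inj ij).
- move=> x; rewrite -cf; apply/codomP/codomP => -[y ->]; first by exists (i y).
  by exists (j y) => /=; rewrite ji.
- by rewrite /= ri.
- by move=> x /=; rewrite pi pf.
Qed.

Lemma iso_tree_remove (A B C : tree) (v : A) (f : B -> A) (i : A -> C) :
  tree_remove v f -> tree_iso i -> tree_remove (i v) (i \o f).
Proof.
move=> [fi cf rf pf] [[j ij ji] ri pi]; split.
- exact: inj_comp (can_inj ij) fi.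
- move=> x; rewrite -{2}(ji x) (can_eq ij) -cf.
  apply/codomP/codomP => -[y]; first by move=> ->; exists y; rewrite /= ij.
  by move=> e; exists y; rewrite /= -e ji.
- by rewrite /= rf ri.
- move=> x /=; rewrite pf -pi (can_eq ij).
  by case: ifP => _; rewrite pi.
Qed.

Lemma card_tree_remove (A B : tree) (v : A) (f : B -> A) :
  tree_remove v f -> #|A| = #|B|.+1.
Proof.
move=> [fi cf _ _]; rewrite -(card_codom fi)
  (eq_card cf : #|codom f| = #|predC1 v|).
by rewrite cardC1 prednK //; apply/card_gt0P; exists v.
Qed.

Section RemoveVertex.
Variables (T : tree) (v : T).
Hypothesis vr : v != tree_root.

Let V := {x : T | x != v}.

Let root_neq : tree_root != v. Proof. by rewrite eq_sym. Qed.

Let par (x : T) := if parent x == v then parent v else parent x.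

Let par_neq (x : T) : par x != v.
Proof.
by rewrite /par; case: ifP => [_|->//]; exact: parent_neq.
Qed.

Let parV (x : V) : V := exist _ (par (val x)) (par_neq (val x)).

Let parV_root : parV (exist _ tree_root root_neq) = exist _ tree_root root_neq.
Proof. by apply: val_inj; rewrite /= /par parent_root (negPf root_neq). Qed.

Let connectV (x : V) : fconnect parV x (exist _ tree_root root_neq).
Proof.
have [n] := reaches_root (val x).
elim/ltn_ind: n x => -[_ x /= e|n IH x].
  by rewrite (_ : x = exist _ tree_root root_neq) ?connect0 //; exact: val_inj.
rewrite iterSr => e; apply: connect_trans (fconnect1 parV x) _.
(* A step of [parV] may skip [v], hence jump over two steps of [parent]. *)
have [pv|pv] := eqVneq (parent (val x)) v; last first.
  by apply: (IH n) => //=; rewrite /par (negPf pv).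
rewrite pv in e; case: n IH e => [|n] IH e.
  by have /eqP := e; rewrite /= (negPf vr).
by apply: (IH n) => //=; rewrite /par pv eqxx -iterSr.
Qed.

Definition remove_vertex : tree := Tree parV_root connectV.

Lemma remove_vertexP : tree_remove v (val : remove_vertex -> T).
Proof.
split=> //.
move=> x; apply/codomP/idP => [[y ->]|xv]; first exact: valP y.
by exists (exist _ x xv).
Qed.

End RemoveVertex.

Lemma only_childP T (v : T) : #|children v| = 1%N ->
  exists2 c, (c != tree_root) && (parent c == v) &
    forall x, x != tree_root -> parent x = v -> x = c.
Proof.
move=> /eqP /cards1P[c cE]; exists c.
  by have := set11 c; rewrite -cE inE.
move=> x xr xv; apply/set1P; rewrite -cE inE xr; exact/eqP.
Qed.

Lemma card_only_child T (v c : T) : c != tree_root -> parent c = v ->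
  (forall x, x != tree_root -> parent x = v -> x = c) -> #|children v| = 1%N.
Proof.
move=> cr pc cE; apply/eqP/cards1P; exists c; apply/setP => x; rewrite !inE.
apply/andP/eqP => [[xr /eqP]|->]; first exact: cE.
by rewrite cr pc.
Qed.

Lemma card_children_inj T (u x y : T) : #|children u| = 1%N ->
  u != tree_root -> parent x = u -> parent y = u -> x = y.
Proof.
move=> /only_childP[c _ cE] ur.
have nr z : parent z = u -> z != tree_root.
  by move=> pz; apply: contraNneq ur => zr; rewrite -pz zr parent_root.
by move=> px py; rewrite (cE _ (nr _ px) px) (cE _ (nr _ py) py).
Qed.

(** If [u] is the only child of [v], its own only child takes its place;
    otherwise the only child of [v] stays. *)
Lemma card_children_remove (A B : tree) (u v : A) (g : B -> A) (v0 : B) :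
  u != tree_root -> tree_remove u g -> g v0 = v -> #|children v| = 1%N ->
  (parent u = v -> #|children u| = 1%N) -> #|children v0| = 1%N.
Proof.
move=> ur gr gv0 dv du; have [gi _ _ pg] := gr.
have v0E y : parent y = v0 ->
    (if parent (g y) == u then parent u else parent (g y)) = v.
  by rewrite -pg -gv0 => ->.
have E0 y : (if parent (g y) == u then parent u else parent (g y)) = v ->
    parent y = v0.
  by rewrite -pg -gv0 => /gi.
have onlychild (c : A) : c != tree_root -> c != u ->
    (if parent c == u then parent u else parent c) = v ->
    (forall y, y != tree_root -> parent y = v0 -> g y = c) ->
    #|children v0| = 1%N.
  move=> cr cu pc cE.
  have [e /(_ tt) eE] :=
    tree_remove_lift (g := fun=> c) gr (fun _ : unit => cu).
  apply: (@card_only_child _ _ (e tt)).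
  - by rewrite -(tree_remove_root _ gr) eE.
  - by apply: E0; rewrite eE.
  - by move=> y yr py; apply: gi; rewrite eE; exact: cE.
have [c /andP[cr /eqP pc] cE] := only_childP dv.
have gr0 y : y != tree_root -> g y != tree_root.
  by rewrite (tree_remove_root _ gr).
have [pu|pu] := eqVneq (parent u) v.
  have [d /andP[dr /eqP pd] dE] := only_childP (du pu).
  apply: (onlychild d) => //; first by rewrite eq_sym -pd parent_neq.
    by rewrite pd eqxx.
  move=> y yr /v0E; case: eqVneq => [pgy _|_ pgy].
    by apply: dE => //; exact: gr0.
  have := tree_remove_neq y gr.
  by rewrite (cE u ur pu) (cE _ (gr0 _ yr) pgy) eqxx.
have vu : v != u by rewrite -gv0; exact: tree_remove_neq gr.
apply: (onlychild c) => //.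
- by apply: contra_neq pu => <-.
- by rewrite pc (negPf vu).
move=> y yr /v0E; case: eqVneq => [_ e|_ pgy]; first by rewrite e eqxx in pu.
by apply: cE => //; exact: gr0.
Qed.

(** Shapes do not remember the order of two removals: either way the vertices
    are those of [T] without [u] and [v], and skipping both on the way up gives
    the same parents because [u] and [v] are not each other's parent. *)
Lemma tree_remove_swap (T A B C : tree) (u v : T) (f : A -> T) (g : B -> T)
    (u0 : A) (v0 : B) (k : C -> B) :
  u != tree_root -> v != tree_root -> u != v ->
  tree_remove v f -> tree_remove u g -> f u0 = u -> g v0 = v ->
  tree_remove v0 k ->
  exists2 h : C -> A, tree_remove u0 h & forall x, f (h x) = g (k x).
Proof.
move=> ur vr uv fr gr fu gv kr.
have [fi _ rf pf] := fr; have [gi _ rg pg] := gr; have [ki ck rk pk] := kr.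
have nv x : g (k x) != v by rewrite -gv (inj_eq gi) (tree_remove_neq _ kr).
have [h hE] := tree_remove_lift fr nv; exists h => //; split.
- by move=> x y e; apply/ki/gi; rewrite -!hE e.
- move=> x; apply/codomP/idP => [[y ->]|xu].
    by rewrite -(inj_eq fi) hE fu (tree_remove_neq _ gr).
  have fxu (_ : unit) : f x != u by rewrite -fu (inj_eq fi).
  have [z /(_ tt) zE] := tree_remove_lift gr fxu.
  have : z tt \in codom k.
    by rewrite ck -(inj_eq gi) zE gv (tree_remove_neq _ fr).
  by move/codomP => [y yE]; exists y; apply: fi; rewrite hE -yE zE.
- by apply: fi; rewrite hE rf rk rg.
move=> x; apply: (fi); rewrite hE pk.
rewrite (fun_if g) !pg -(inj_eq gi) pg gv (fun_if f) !pf -(inj_eq fi) pf fu hE.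
have pvu : ~ (parent v = u /\ parent u = v).
  by move=> [<-]; apply/eqP/grandparent_neq.
case: (eqVneq (parent (g (k x))) u) => [->|pu].
  rewrite (negPf uv) eqxx; case: eqVneq => pu; last by [].
  by case: eqVneq => // pv; case: pvu.
case: (eqVneq (parent (g (k x))) v) => [_|_]; last by rewrite (negPf pu).
by case: eqVneq => // pv; case: eqVneq => // pu'; case: pvu.
Qed.

Lemma card_children_iso (A B : tree) (f : A -> B) (v : A) :
  tree_iso f -> #|children (f v)| = #|children v|.
Proof.
move=> fi; have [[g fg gf] _ pf] := fi.
rewrite -(card_imset (mem (children v)) (can_inj fg)); apply: eq_card => y.
apply/idP/imsetP => [|[x + ->]]; rewrite inE.
  move=> yc; exists (g y); rewrite ?gf // inE -(tree_iso_root _ fi) gf.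
  by rewrite -(can_eq fg) pf gf.
by rewrite inE (tree_iso_root _ fi) -pf (can_eq fg).
Qed.

End Trees.

(** * Editable spaces *)

Section EditableSpace.
Context {R : realType} {X : editableSpace R}.
Implicit Types x y z : X.

Lemma dX_ge0 x y : 0 <= dX x y.
Proof. by have [+ _ _ _] := dX_metric X; exact. Qed.

Lemma dX_eq0 x y : dX x y = 0 <-> x = y.
Proof. by have [_ + _ _] := dX_metric X; exact. Qed.

Lemma dXxx x : dX x x = 0. Proof. exact/dX_eq0. Qed.

Lemma dXC x y : dX x y = dX y x.
Proof. by have [_ _ + _] := dX_metric X; exact. Qed.

Lemma dX_triangle y x z : dX x z <= dX x y + dX y z.
Proof. by have [_ _ _ +] := dX_metric X; exact. Qed.

Lemma dX_gt0 x y : x != y -> 0 < dX x y.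
Proof.
move=> /eqP xy; rewrite lt_neqAle dX_ge0 andbT eq_sym.
by apply/eqP => /dX_eq0.
Qed.

Lemma dXD_0 x y : dX (x + y) 0 = dX x 0 + dX y 0.
Proof. by rewrite dXC dX0D !(dXC 0). Qed.

Lemma le_dXD x x' y y' : dX (x + y) (x' + y') <= dX x x' + dX y y'.
Proof.
by apply: le_trans (dX_triangle (x' + y) _ _) _; rewrite -dXDr -dXDl.
Qed.

Lemma dX_addl x y : dX (x + y) x = dX y 0.
Proof. by rewrite -{2}(addr0 x) -dXDl. Qed.

Lemma addX_eq0 x y : x != 0 -> x + y != 0.
Proof.
move=> /dX_gt0 x0; apply/eqP => e.
have := dXD_0 x y; rewrite e dXxx; have := dX_ge0 y 0; lra.
Qed.

End EditableSpace.

(** * Closeness of dendrograms, reductions *)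

Section Rearrangement.
Context {R : realType} {X : editableSpace R}.
Implicit Types (S T A B : dendrogram X) (a b c : R).

Lemma weight_root T : weight (tree_root : T) = 0.
Proof. by apply/eqP; rewrite weight_eq0. Qed.

(** The slack in the inequality absorbs the savings made when paths are
    rearranged, so that all other costs can be kept exact. *)
Definition close T S c : Prop :=
  exists2 f : T -> S, tree_iso f &
    \sum_(x : T) dX (weight x) (weight (f x)) <= c.

Lemma iso_close T S : dendrogram_iso T S -> close T S 0.
Proof.
move=> [f fi wf]; exists f => //.
by rewrite big1 // => x _; rewrite wf dXxx.
Qed.

Lemma close_iso T S c : close T S c ->
  (forall (x : T) (y : S), weight x != weight y ->
    c < dX (weight x) (weight y)) ->
  dendrogram_iso T S.
Proof.
move=> [f fi le_c] sep; exists f => // x; apply/eqP; apply: contraT => neq.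
rewrite eq_sym in neq.
have := sep _ _ neq; rewrite ltNge; apply: contraNT => _.
apply: le_trans le_c; rewrite (bigD1 x) //= lerDl.
by apply: sumr_ge0 => y _; exact: dX_ge0.
Qed.

Lemma close_ge0 T S c : close T S c -> 0 <= c.
Proof.
move=> [f _]; apply: le_trans; apply: sumr_ge0 => x _; exact: dX_ge0.
Qed.

Lemma close_refl T : close T T 0.
Proof. by apply: iso_close; exists id => //; exact: tree_iso_refl. Qed.

Lemma close_sym T S c : close T S c -> close S T c.
Proof.
move=> [f fi le_c]; have [g [gi fg gf]] := tree_iso_inv fi.
exists g => //; rewrite (reindex f) /=; last first.
  by case: fi => [[h ? ?] _ _]; exists h => *.
by under eq_bigr do rewrite fg dXC.
Qed.

Lemma close_trans S T A c c' :
  close T S c -> close S A c' -> close T A (c + c').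
Proof.
move=> [f fi le_c] [g gi le_c']; exists (g \o f); first exact: tree_iso_comp.
rewrite (reindex f) /= in le_c'; last first.
  by case: fi => [[h ? ?] _ _]; exists h => *.
apply: le_trans (lerD le_c le_c'); rewrite -big_split /=.
by apply: ler_sum => x _; exact: dX_triangle.
Qed.

Lemma close_le T S c c' : c <= c' -> close T S c -> close T S c'.
Proof. by move=> le_c [f fi le]; exists f => //; exact: le_trans le_c. Qed.

(** The weight that [x] inherits when [v] is removed: that of [v] if [v] is
    ghosted ([g = true]) and [x] is its child, none if [v] is deleted. *)
Definition transfer (g : bool) T (v x : T) : X :=
  if g && (parent x == v) then weight v else 0.

(** Deletion and ghosting in a single form, the boolean [g] telling ghosting, so
    that the commutation lemmas treat both at once. *)
Definition removal (g : bool) T (v : T) S : Prop :=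
  [/\ v != tree_root, g -> #|children v| = 1%N &
      exists2 f : S -> T, tree_remove v f &
        forall x : S, weight x = weight (f x) + transfer g v (f x)].

Definition reduction T S a : Prop :=
  exists g (v : T), removal g v S /\ a = if g then 0 else dX (weight v) 0.

Lemma deletionE T (v : T) S : deletion v S <-> removal false v S.
Proof.
split=> [[vr [f fr wf]]|[vr _ [f fr wf]]].
  by split=> //; exists f => // x; rewrite wf addr0.
by split=> //; exists f => // x; rewrite wf addr0.
Qed.

Lemma ghostingE T (v : T) S : ghosting v S <-> removal true v S.
Proof.
split=> [[[vr d2] [f fr wf]]|[vr d2 [f fr wf]]].
  split=> //; exists f => // x; rewrite wf /transfer /=.
  by case: ifP; rewrite ?addr0.
split; first by split=> //; exact: d2.
by exists f => // x; rewrite wf /transfer /=; case: ifP; rewrite ?addr0.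
Qed.

Lemma reduction_ge0 T S a : reduction T S a -> 0 <= a.
Proof. by move=> [g [v [_ ->]]]; case: g => //; exact: dX_ge0. Qed.

(** A ghosted vertex has one child, so the errors that its weight passes on to
    its children count once. *)
Lemma transfer_sum_le T (v : T) (g : bool) (k : R) : v != tree_root ->
  (g -> #|children v| = 1%N) -> 0 <= k ->
  \sum_(x | x != v) (if g && (parent x == v) then k else 0) <=
  if g then k else 0.
Proof.
move=> vr; case: g => [/(_ isT) d2 k0|_ k0] /=; last by rewrite big1.
have [c /andP[cr /eqP pc] cE] := only_childP d2.
have cv : c != v by rewrite eq_sym -pc parent_neq.
rewrite (bigD1 c) //= pc eqxx big1 ?addr0// => x /andP[_ xc].
case: eqVneq => // pv; case/eqP: xc; apply: cE => //.
by apply: contraNneq vr => xr; rewrite -pv xr parent_root.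
Qed.

Lemma sum_tree_remove T S (v : T) (f : S -> T) (F : T -> R) :
  tree_remove v f -> \sum_(x : S) F (f x) = \sum_(x | x != v) F x.
Proof.
move=> [fi cf _ _]; rewrite -[RHS](eq_bigl _ _ cf) -big_uniq /=.
  by rewrite big_map big_enum.
by rewrite map_inj_uniq ?enum_uniq.
Qed.

Lemma transfer_root T (v : T) (g : bool) : v != tree_root ->
  transfer g v tree_root = 0.
Proof. by move=> vr; rewrite /transfer parent_root eq_sym (negPf vr) andbF. Qed.

(** No edge becomes trivial: norms add up, so a sum with a nonzero term is
    nonzero. *)
Lemma removal_weight_eq0 T (v : T) (g : bool) (B : tree) (f : B -> T) (x : B) :
  v != tree_root -> tree_remove v f ->
  (weight (f x) + transfer g v (f x) == 0) = (x == tree_root).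
Proof.
move=> vr fr; have [xr|xr] := eqVneq x tree_root.
  rewrite xr; case: fr => _ _ -> _.
  by rewrite weight_root transfer_root ?addr0 ?eqxx.
by apply/negbTE/addX_eq0; rewrite weight_eq0 (tree_remove_root _ fr).
Qed.

Definition removed T (v : T) (g : bool) (B : tree) (f : B -> T)
    (vr : v != tree_root) (fr : tree_remove v f) : dendrogram X :=
  Dendrogram (fun x : B => removal_weight_eq0 g x vr fr).

Lemma removedP T (v : T) (g : bool) (B : tree) (f : B -> T)
    (vr : v != tree_root) (fr : tree_remove v f) :
  (g -> #|children v| = 1%N) -> removal g v (removed g vr fr).
Proof. by move=> d2; split=> //; exists f. Qed.

(** The vertex corresponding to [v] is removed from [S]. If [v] is deleted, the
    term of [v] leaves the sum of the changes, and pays for the difference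
    between the two deletion costs; if it is ghosted, that term is added to the
    term of its child. *)
Lemma close_reduction T S T' c a : close T S c -> reduction T T' a ->
  exists S' b, reduction S S' b /\ close T' S' (c + a - b).
Proof.
move=> [f fi le_c] [g [v [[vr d2 [h hr wh]] ->]]].
have fvr : f v != tree_root by rewrite (tree_iso_root _ fi).
have d2f : g -> #|children (f v)| = 1%N.
  by move=> gT; rewrite (card_children_iso _ fi) d2.
exists (removed g fvr (iso_tree_remove hr fi)).
exists (if g then 0 else dX (weight (f v)) 0); split.
  by exists g, (f v); split=> //; exact: removedP.
exists id; first exact: tree_iso_refl.
pose F (x : T) := dX (weight x) (weight (f x)).
pose G (x : T) := if g && (parent x == v) then F v else 0.
have le_sum : \sum_(x : T') dX (weight x)
      (weight (x : removed g fvr (iso_tree_remove hr fi)))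
    <= \sum_(x : T') (F (h x) + G (h x)).
  apply: ler_sum => x _ /=; rewrite wh; apply: le_trans (le_dXD _ _ _ _) _.
  rewrite lerD2l /transfer /G; have [[k fk _] _ pf] := fi.
  by rewrite -pf (can_eq fk); case: ifP; rewrite ?dXxx.
apply: le_trans le_sum _; rewrite (sum_tree_remove (fun x => F x + G x) hr).
rewrite big_split /=.
have le_G : \sum_(x | x != v) G x <= if g then F v else 0.
  by apply: transfer_sum_le => //; exact: dX_ge0.
have le_F : F v + \sum_(x | x != v) F x <= c.
  by move: le_c; rewrite (bigD1 v).
have := dX_triangle (weight v) (weight (f v)) 0; rewrite (dXC _ (weight v)).
rewrite -/(F v); move: le_G le_F.
by case: (g); lra.
Qed.

(** * Two reductions of the same dendrogram *)

(** Ghosting [v] and deleting [v] differ only in the weight of the child of [v],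
    by the weight of [v]. *)
Lemma peak_same T (v : T) g1 g2 S1 S2 :
  removal g1 v S1 -> removal g2 v S2 ->
  close S1 S2 ((if g1 then 0 else dX (weight v) 0) +
               (if g2 then 0 else dX (weight v) 0)).
Proof.
move=> [vr d1 [f1 fr1 w1]] [_ d2 [f2 fr2 w2]].
have [h hE] := tree_remove_lift fr2 (fun x => tree_remove_neq x fr1).
have [k kE] := tree_remove_lift fr1 (fun x => tree_remove_neq x fr2).
have [fi1 _ r1 p1] := fr1; have [fi2 _ r2 p2] := fr2.
exists h; first split.
- by exists k => x; [apply: fi1; rewrite kE hE|apply: fi2; rewrite hE kE].
- by apply: fi2; rewrite hE r1 r2.
- by move=> x; apply: fi2; rewrite hE p1 p2 hE.
have d : g1 (+) g2 -> #|children v| = 1%N.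
  by case: g1 d1 {w1} => d1; case: g2 d2 {w2} => d2 //= _; auto.
pose D := dX (weight v) 0.
pose G (x : T) := if (g1 (+) g2) && (parent x == v) then D else 0.
have D0 : 0 <= D by exact: dX_ge0.
apply: (@le_trans _ _ (\sum_(x : S1) G (f1 x))).
  apply: ler_sum => x _; rewrite w1 w2 hE -dXDl /transfer /G.
  by case: (parent _ == v); case: (g1); case: (g2); rewrite /= ?dXxx // dXC.
rewrite (sum_tree_remove G fr1).
apply: le_trans (transfer_sum_le vr d D0) _.
by rewrite -/D; case: (g1); case: (g2); rewrite /= ?addr0 ?add0r // addr_ge0.
Qed.

(** With [u] the only child of [v], ghosting [v] keeps [u] with the summed
    weight, while deleting [u] keeps [v], with its own weight and the children
    of [u]. Exchanging [u] and [v] is an isomorphism of the resulting shapes. *)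
Lemma peak_ghost_delete_child T (v u : T) S1 S2 : parent u = v ->
  removal true v S1 -> removal false u S2 -> close S1 S2 (dX (weight u) 0).
Proof.
move=> pu [vr /(_ isT) d2 [f fr wf]] [ur _ [g gr wg]].
have uv : u != v by rewrite eq_sym -pu parent_neq.
have [fi _ rf pf] := fr; have [gi _ rg pg] := gr.
have nu x : (if f x == u then v else f x) != u.
  by case: ifP => [_|->//]; rewrite eq_sym.
have nv y : (if g y == v then u else g y) != v by case: ifP => [_|->].
have [h hE] := tree_remove_lift gr nu.
have [k kE] := tree_remove_lift fr nv.
have pfE x : parent (f x) = v -> f x = u.
  by move=> px; exact: (card_children_inj d2 vr px pu).
exists h; first split.
- exists k => x; [apply: fi; rewrite kE hE|apply: gi; rewrite hE kE].
    by case: (eqVneq (f x) u) => [->|_];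
      rewrite ?eqxx // (negPf (tree_remove_neq _ fr)).
  by case: (eqVneq (g x) v) => [->|_];
    rewrite ?eqxx // (negPf (tree_remove_neq _ gr)).
- by apply: gi; rewrite hE rf rg eq_sym (negPf ur).
- move=> x; apply: gi; rewrite hE pg hE pf.
  have [fu|fu] := eqVneq (f x) u.
    rewrite fu pu eqxx.
    have /negPf -> : parent v != u by rewrite -pu grandparent_neq.
    by [].
  have [px|px] := eqVneq (parent (f x)) v.
    by rewrite (pfE _ px) eqxx in fu.
  by rewrite pu.
pose G (x : T) := if x == u then dX (weight u) 0 else 0.
apply: (@le_trans _ _ (\sum_(x : S1) G (f x))); last first.
  rewrite (sum_tree_remove G fr) (bigD1 u) //= /G eqxx big1 ?addr0 //.
  by move=> x /andP[_ /negPf ->].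
apply: ler_sum => x _; rewrite wf wg hE /transfer /= addr0 /G.
have [fu|fu] := eqVneq (f x) u.
  by rewrite fu pu eqxx addrC dX_addl.
by case: eqVneq => [/pfE e|_]; [rewrite e eqxx in fu|rewrite addr0 dXxx].
Qed.

(** Away from the exceptional configurations both orders of removal can be
    carried out, at unchanged costs, and give the same result; when both
    vertices are ghosted and one is the parent of the other, the weights agree
    by associativity. *)
Lemma peak_generic T (v u : T) g1 g2 S1 S2 : u != v ->
  removal g1 v S1 -> removal g2 u S2 ->
  ~~ [&& g1, ~~ g2 & parent u == v] -> ~~ [&& g2, ~~ g1 & parent v == u] ->
  exists A B, [/\ reduction S2 A (if g1 then 0 else dX (weight v) 0),
    reduction S1 B (if g2 then 0 else dX (weight u) 0) & close A B 0].
Proof.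
move=> uv [vr d1 [f fr wf]] [ur d2 [g gr wg]] ex1 ex2.
have [fi _ rf pf] := fr; have [gi _ rg pg] := gr.
have vu : v != u by rewrite eq_sym.
have [u_ /(_ tt)] := tree_remove_lift fr (fun _ : unit => uv).
move: (u_ tt) => u0 fu {u_}.
have [v_ /(_ tt)] := tree_remove_lift gr (fun _ : unit => vu).
move: (v_ tt) => v0 gv {v_}.
have v0r : v0 != tree_root by rewrite -(tree_remove_root _ gr) gv.
have u0r : u0 != tree_root by rewrite -(tree_remove_root _ fr) fu.
have d1' : g1 -> #|children v0| = 1%N.
  move=> g1T; apply: (card_children_remove ur gr gv (d1 g1T)) => puv.
  by apply: d2; move: ex1; rewrite g1T puv eqxx andbT negbK.
have d2' : g2 -> #|children u0| = 1%N.
  move=> g2T; apply: (card_children_remove vr fr fu (d2 g2T)) => pvu.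
  by apply: d1; move: ex2; rewrite g2T pvu eqxx andbT negbK.
have kr := remove_vertexP v0r.
have [h hr hE] := tree_remove_swap ur vr uv fr gr fu gv kr.
exists (removed g1 v0r kr), (removed g2 u0r hr); split.
- exists g1, v0; split; first exact: removedP.
  case: (g1) ex2 => //; rewrite wg gv /transfer andTb => /negPf ->.
  by rewrite addr0.
- exists g2, u0; split; first exact: removedP.
  case: (g2) ex1 => //; rewrite wf fu /transfer andTb => /negPf ->.
  by rewrite addr0.
apply: iso_close; exists id; first exact: tree_iso_refl.
move=> x /=; rewrite /transfer !wg !wf /transfer hE fu gv.
rewrite -(inj_eq gi) pg gv -(inj_eq fi) pf fu hE.
(* It remains to compare the weight that [y] gets in either order. What makes
   them agree: an only child of a ghosted vertex is unique, and [u], [v] are not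
   each other's parent. *)
set y := g _.
have yu : y != u by exact: tree_remove_neq gr.
have yv : y != v by rewrite /y -gv (inj_eq gi); exact: tree_remove_neq kr.
have n1 : ~~ [&& g1, parent y == v & parent u == v].
  apply/and3P => -[/d1 d /eqP py /eqP pu].
  by rewrite (card_children_inj d vr py pu) eqxx in yu.
have n2 : ~~ [&& g2, parent y == u & parent v == u].
  apply/and3P => -[/d2 d /eqP py /eqP pu].
  by rewrite (card_children_inj d ur py pu) eqxx in yv.
have n3 : ~~ ((parent u == v) && (parent v == u)).
  apply/andP => -[/eqP pu /eqP pv]; have := grandparent_neq vr.
  by rewrite pv pu eqxx.
have n4 : ~~ ((parent y == u) && (parent y == v)).
  by apply/andP => -[/eqP -> /eqP e]; rewrite e eqxx in uv.
have ifE (b : bool) (p q r : T) :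
    ((if b then p else q) == r) = (if b then p == r else q == r) by case: b.
rewrite !ifE; move: ex1 ex2 n1 n2 n3 n4.
case: (parent y == u); case: (parent y == v);
  case: (parent u == v); case: (parent v == u); case: (g1); case: (g2);
  rewrite //= ?addr0 ?addrA // => *; by rewrite addrAC.
Qed.

Definition reduction1 T S a : Prop := (T = S /\ a = 0) \/ reduction T S a.

Lemma local_peak T S1 S2 a1 a2 : reduction T S1 a1 -> reduction T S2 a2 ->
  exists A B x1 x2, [/\ reduction1 S1 A x1, reduction1 S2 B x2 &
    close A B (a1 + a2 - x1 - x2)].
Proof.
move=> [g1 [v [r1 ->]]] [g2 [u [r2 ->]]].
have stay c : close S1 S2 c ->  c <= (if g1 then 0 else dX (weight v) 0) +
      (if g2 then 0 else dX (weight u) 0) ->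
    exists A B x1 x2, [/\ reduction1 S1 A x1, reduction1 S2 B x2 &
      close A B ((if g1 then 0 else dX (weight v) 0) +
      (if g2 then 0 else dX (weight u) 0) - x1 - x2)].
  move=> cl le_c; exists S1, S2, 0, 0; split; [by left|by left|].
  by rewrite !subr0; exact: close_le cl.
have [e|uv] := eqVneq u v.
  by subst u; apply: stay (lexx _); exact: peak_same.
have [ex1|ex1] := boolP [&& g1, ~~ g2 & parent u == v].
  case/and3P: ex1 r1 r2 stay => -> /negPf -> /eqP pu r1 r2; apply.
    exact: peak_ghost_delete_child pu r1 r2.
  by rewrite add0r.
have [ex2|ex2] := boolP [&& g2, ~~ g1 & parent v == u].
  case/and3P: ex2 r1 r2 stay => -> /negPf -> /eqP pv r1 r2; apply.
    exact: close_sym (peak_ghost_delete_child pv r2 r1).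
  by rewrite addr0.
have [A [B [rA rB cl]]] := peak_generic uv r1 r2 ex1 ex2.
exists B, A, (if g2 then 0 else dX (weight u) 0),
  (if g1 then 0 else dX (weight v) 0).
split; [by right|by right|].
by rewrite addrK subrr; exact: close_sym.
Qed.

(** * Rearranging edit paths *)

Inductive reductions : dendrogram X -> dendrogram X -> R -> Prop :=
| reductions_nil T : reductions T T 0
| reductions_cons T A S a c of reduction T A a & reductions A S c :
    reductions T S (a + c).

Lemma reductions_ge0 T S c : reductions T S c -> 0 <= c.
Proof.
by elim=> // {}T A {}S a {}c r _ c0; rewrite addr_ge0 // (reduction_ge0 r).
Qed.

Lemma reductions_rcons T A S a c :
  reductions T A a -> reduction A S c -> reductions T S (a + c).
Proof.
elim=> {T A a} [T rTS|T B A a b rTB _ IH rAS].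
  by rewrite add0r -(addr0 c); exact: reductions_cons rTS (reductions_nil _).
by rewrite -addrA; apply: reductions_cons rTB (IH rAS).
Qed.

Lemma reduction1_cons T A S a c :
  reduction1 T A a -> reductions A S c -> reductions T S (a + c).
Proof.
by move=> [[-> ->]|rTA] rAS; [rewrite add0r|exact: reductions_cons rTA rAS].
Qed.

Lemma close_reductions T S T' c a : close T S c -> reductions T T' a ->
  exists S' b, reductions S S' b /\ close T' S' (c + a - b).
Proof.
move=> cl rT; elim: rT S c cl => {T T' a} [T|T A T' a a' rTA _ IH] S c cl.
  by exists S, 0; split; [exact: reductions_nil|rewrite subr0 addr0].
have [B [b [rSB clAB]]] := close_reduction cl rTA.
have [S' [b' [rBS' clTS]]] := IH _ _ clAB.
exists S', (b + b'); split; first exact: reductions_cons rSB rBS'.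
by apply: close_le clTS; lra.
Qed.

(** A single reduction is pushed through a sequence of reductions, one local
    peak at a time. It remains a single reduction, or vanishes, on the side of
    [S1]; this is why the induction closes. *)
Lemma peak T S1 S2 a1 a2 : reductions T S1 a1 -> reduction T S2 a2 ->
  exists A B x1 x2, [/\ reduction1 S1 A x1, reductions S2 B x2 &
    close A B (a1 + a2 - x1 - x2)].
Proof.
move=> rT; elim: rT S2 a2 => {T S1 a1} [T|T A S1 a a' rTA rAS IH] S2 a2 rTS2.
  exists S2, S2, a2, 0; split; [by right|exact: reductions_nil|].
  by rewrite add0r subrr subr0; exact: close_refl.
have [P [Q [x [y [rAP rSQ clPQ]]]]] := local_peak rTA rTS2.
case: rAP => [[eAP x0]|rAP].
  subst P x.
  have [B [b [rQB clSB]]] := close_reductions clPQ rAS.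
  exists S1, B, 0, (y + b); split; [by left|exact: reduction1_cons rSQ rQB|].
  by apply: close_le clSB; lra.
have [C [D [z [t [rSC rPD clCD]]]]] := IH _ _ rAP.
have [B [b [rQB clDB]]] := close_reductions clPQ rPD.
exists C, B, z, (y + b); split; [by []|exact: reduction1_cons rSQ rQB|].
by apply: close_le (close_trans clCD clDB); lra.
Qed.

(** The normal form of edit paths. *)
Definition matched T S c : Prop := exists T0 S0 a b,
  [/\ reductions T T0 a, reductions S S0 b & close T0 S0 (c - a - b)].

Lemma matched_reduction T S S' c e :
  matched T S c -> reduction S S' e -> matched T S' (c + e).
Proof.
move=> [T0 [S0 [a [b [rT rS cl]]]]] rSS'.
have [A [B [x [y [rSA rSB clAB]]]]] := peak rS rSS'.
case: rSA => [[eSA x0]|rSA].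
  subst A x; exists T0, B, a, y; split=> //.
  by apply: close_le (close_trans cl clAB); lra.
have [T1 [z [rT1 clT1]]] := close_reduction (close_sym cl) rSA.
exists T1, B, (a + z), y; split=> //; first exact: reductions_rcons rT rT1.
by apply: close_le (close_trans (close_sym clT1) clAB); lra.
Qed.

Lemma matched_expansion T S S' c e :
  matched T S c -> reduction S' S e -> matched T S' (c + e).
Proof.
move=> [T0 [S0 [a [b [rT rS cl]]]]] rSS'.
exists T0, S0, a, (e + b); split=> //; first exact: reductions_cons rSS' rS.
by apply: close_le cl; lra.
Qed.

Lemma matched_close T S S' c e :
  matched T S c -> close S S' e -> matched T S' (c + e).
Proof.
move=> [T0 [S0 [a [b [rT rS cl]]]]] clS.
have [S1 [b' [rS1 clS1]]] := close_reductions clS rS.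
exists T0, S1, a, b'; split=> //.
by apply: close_le (close_trans cl clS1); lra.
Qed.

Lemma shrinking_close T (v : T) (y : X) S :
  shrinking v y S -> close T S (dX (weight v) y).
Proof.
move=> [vr y0 [f fi wf]]; exists f => //.
rewrite (bigD1 v) //= big1 ?addr0 => [|x /negPf xv].
  by rewrite wf eqxx.
by rewrite wf xv dXxx.
Qed.

Lemma editP T S c : edit T S c ->
  [\/ exists (v : T) (y : X), shrinking v y S /\ c = dX (weight v) y,
      reduction T S c | reduction S T c].
Proof.
case=> {c} [v y h|v h|v h|v h|v h].
- by constructor 1; exists v, y.
- by constructor 2; exists false, v; split=> //; exact/deletionE.
- by constructor 3; exists false, v; split=> //; exact/deletionE.
- by constructor 2; exists true, v; split=> //; exact/ghostingE.
- by constructor 3; exists true, v; split=> //; exact/ghostingE.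
Qed.

Lemma reduction_edit T S c : reduction T S c -> edit T S c /\ edit S T c.
Proof.
move=> [[] [v [h ->]]].
  by move/ghostingE in h; split; [exact: edit_ghost h|exact: edit_split h].
by move/deletionE in h; split; [exact: edit_delete h|exact: edit_insert h].
Qed.

(** Normal forms are stable under appending an edit, whence the induction from
    the left end of the path. *)
Lemma edit_path_matched T S c : edit_path T S c -> matched T S c.
Proof.
suff H A a : edit_path A S c -> matched T A a -> matched T S (a + c).
  move=> h; rewrite -(add0r c); apply: (H T) => //.
  exists T, T, 0, 0; rewrite !subr0.
  by split; [exact: reductions_nil|exact: reductions_nil|exact: close_refl].
move=> p; elim: p a => {A S c} [A S iAS|A S B c c' eAB _ IH] a m.
  exact: matched_close m (iso_close iAS).
rewrite addrA; apply: IH; case: (editP eAB) => [[v [y [h ->]]]|h|h].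
- exact: matched_close m (shrinking_close h).
- exact: matched_reduction m h.
- exact: matched_expansion m h.
Qed.

(** * Cheap edit paths *)

(** Each ghosting adds two weights, so [n] ghostings of a dendrogram with
    weights in [F] yield weights in [sums n F]. *)
Fixpoint sums (n : nat) (F : seq X) : seq X :=
  if n is m.+1 then sums m (F ++ [seq x + y | x <- F, y <- F]) else F.

Lemma sub_sums n (F : seq X) : {subset F <= sums n F}.
Proof.
elim: n F => [|n IH] F x xF //=; apply: IH.
by rewrite mem_cat xF.
Qed.

(** A deletion costs the norm of a weight, and [e] bounds these norms from
    below; [#|T|] bounds the number of reductions. *)
Lemma cheap_reductions n (F : seq X) e T S c : 0 \in F ->
  (forall x, x \in sums n F -> x != 0 -> e <= dX x 0) ->
  reductions T S c -> c < e -> (#|T| <= n)%N ->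
  (forall x : T, weight x \in F) ->
  clos_refl_trans _ ghost_or_split T S /\ (forall x : S, weight x \in sums n F).
Proof.
move=> F0 He rTS; elim: rTS n F F0 He => {T S c} [T|T A S a c rTA rAS IH]
  n F F0 He lt_e.
  by move=> _ wF; split=> [|x]; [exact: rt_refl|exact/sub_sums].
move: rTA => [g [v [rem ea]]].
have [vr d2 [f fr wf]] := rem.
have := card_tree_remove fr; case: n He => [|n] He cA;
  rewrite cA // ltnS => le_n wF.
have gT : g.
  apply: contraT => /negPf gF; rewrite gF in ea.
  have := He (weight v) (sub_sums _ (wF v)).
  rewrite weight_eq0 vr -ea => /(_ isT).
  by have := reductions_ge0 rAS; lra.
rewrite gT in ea rem.
have [|||x|p wS] := IH n (F ++ [seq x + y | x <- F, y <- F]) _ He => //.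
- by rewrite mem_cat F0.
- by rewrite ea add0r in lt_e.
(* An edge that inherits nothing has weight [weight _ + 0], whence [0 \in F]. *)
- rewrite wf /transfer mem_cat; apply/orP; right.
  apply/allpairsP; exists (weight (f x),
    if g && (parent (f x) == v) then weight v else 0).
  by split=> //=; case: ifP.
split=> //; apply: rt_trans p; apply: rt_step; left; exists v.
exact/ghostingE.
Qed.

Lemma positive_gap (s : seq R) :
  exists2 e, 0 < e & forall r, r \in s -> 0 < r -> e <= r.
Proof.
elim: s => [|r s [e e0 He]]; first by exists 1.
exists (if 0 < r then Num.min r e else e).
  by case: ifP => // r0; rewrite lt_min r0.
move=> r'; rewrite inE => /orP[/eqP ->|/He h] r'0.
  by rewrite r'0 ge_min lexx.
by case: ifP => _; rewrite ?ge_min h ?orbT.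
Qed.

(** A common set [F] of weights is taken for both trees, so that one gap
    separates the weights of their reducts from each other and from [0]. *)
Lemma cheap_path_eq_deg2 T T' :
  exists2 e, 0 < e & forall c, edit_path T T' c -> c < e -> eq_deg2 T T'.
Proof.
pose F := 0 :: [seq weight x | x : T] ++ [seq weight x | x : T'].
pose n := (#|T| + #|T'|)%N; pose G := sums n F.
have [e e0 He] := positive_gap [seq dX x y | x <- G, y <- G].
have {}He x y : x \in G -> y \in G -> x != y -> e <= dX x y.
  by move=> xG yG xy; apply: He (dX_gt0 xy); apply/allpairsP; exists (x, y).
have F0 : 0 \in F by rewrite inE eqxx.
have He0 x : x \in sums n F -> x != 0 -> e <= dX x 0.
  by move=> xG; apply: He => //; exact: sub_sums.
exists e => // c /edit_path_matched[S [S' [a [b [rT rT' cl]]]]] lt_e.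
have := reductions_ge0 rT; have := reductions_ge0 rT'; have := close_ge0 cl.
move=> c0 b0 a0.
have [||x|pT wS] := cheap_reductions F0 He0 rT.
- by lra.
- exact: leq_addr.
- by rewrite inE mem_cat fintype.image_f // orbT.
have [||x|pT' wS'] := cheap_reductions F0 He0 rT'.
- by lra.
- exact: leq_addl.
- by rewrite inE mem_cat fintype.image_f // !orbT.
exists S, S'; split=> //; apply: close_iso cl _ => x y xy.
have := He _ _ (wS x) (wS' y) xy; lra.
Qed.

(** * The edit pseudometric *)

Lemma dendrogram_iso_refl T : dendrogram_iso T T.
Proof. by exists id => //; exact: tree_iso_refl. Qed.

Lemma dendrogram_iso_sym T S : dendrogram_iso T S -> dendrogram_iso S T.
Proof.
move=> [f fi wf]; have [g [gi fg gf]] := tree_iso_inv fi.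
by exists g => // x; rewrite -{2}(gf x) wf.
Qed.

Lemma dendrogram_iso_trans A T S :
  dendrogram_iso T A -> dendrogram_iso A S -> dendrogram_iso T S.
Proof.
move=> [f fi wf] [g gi wg]; exists (g \o f); first exact: tree_iso_comp.
by move=> x /=; rewrite wg wf.
Qed.

Lemma reduction_iso_r T S A c : reduction T S c -> dendrogram_iso S A ->
  reduction T A c.
Proof.
move=> [g [v [[vr d2 [f fr wf]] ->]]] /dendrogram_iso_sym[i ii wi].
exists g, v; split=> //; split=> //; exists (f \o i).
  exact: tree_remove_iso.
by move=> x /=; rewrite -wi wf.
Qed.

Lemma reduction_iso_l T S A c : dendrogram_iso A T -> reduction T S c ->
  reduction A S c.
Proof.
move=> /dendrogram_iso_sym[i ii wi] [g [v [[vr d2 [f fr wf]] ->]]].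
exists g, (i v); split; last by rewrite wi.
split; first by rewrite (tree_iso_root _ ii).
  by move=> gT; rewrite (card_children_iso _ ii) d2.
exists (i \o f); first exact: iso_tree_remove.
move=> x; rewrite wf /= wi /transfer wi.
by have [/bij_inj inj_i _ pi] := ii; rewrite -pi (inj_eq inj_i).
Qed.

Lemma edit_iso_l T S A c : dendrogram_iso A T -> edit T S c -> edit A S c.
Proof.
move=> iso /editP[[v [y [[vr y0 [f fi wf]] ->]]]|h|h]; last 2 first.
- by have [] := reduction_edit (reduction_iso_l iso h).
- by have [] := reduction_edit (reduction_iso_r h (dendrogram_iso_sym iso)).
have [i ii wi] := iso; have [j [ji ij jj]] := tree_iso_inv ii.
rewrite -(jj v) wi; apply: edit_shrink; split=> //.
  by rewrite (tree_iso_root _ ji).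
exists (f \o i); first exact: tree_iso_comp.
by move=> x /=; rewrite wf wi -(can_eq ij) jj.
Qed.

Lemma edit_sym T S c : edit T S c -> edit S T c.
Proof.
move=> /editP[[v [y [[vr y0 [f fi wf]] ->]]]|h|h]; last 2 first.
- by have [] := reduction_edit h.
- by have [] := reduction_edit h.
have [g [gi fg gf]] := tree_iso_inv fi.
have wv : weight (f v) = y by rewrite wf eqxx.
rewrite dXC -wv; apply: edit_shrink; split.
- by rewrite (tree_iso_root _ fi).
- by rewrite weight_eq0.
exists g => // x; rewrite -(can_eq gf) fg; case: eqVneq => [->//|xv].
by rewrite -{2}(gf x) wf (negPf xv).
Qed.

Lemma edit_path_iso_l T S A c :
  dendrogram_iso A T -> edit_path T S c -> edit_path A S c.
Proof.
move=> iso [i|B e e' h p]; first exact/edit_path_nil/(dendrogram_iso_trans iso).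
exact: edit_path_cons (edit_iso_l iso h) p.
Qed.

Lemma edit_path_trans T A S c c' :
  edit_path T A c -> edit_path A S c' -> edit_path T S (c + c').
Proof.
move=> p; elim: p => {T A c} [T A iso|T A B e e' h _ IH] q.
  by rewrite add0r; exact: edit_path_iso_l iso q.
by rewrite -addrA; apply: edit_path_cons h (IH q).
Qed.

Lemma edit_path1 T S c : edit T S c -> edit_path T S c.
Proof.
move=> h; rewrite -(addr0 c); apply: edit_path_cons h _.
exact/edit_path_nil/dendrogram_iso_refl.
Qed.

Lemma edit_path_sym T S c : edit_path T S c -> edit_path S T c.
Proof.
elim=> {T S c} [T S iso|T S A e e' h _ IH].
  exact/edit_path_nil/dendrogram_iso_sym.
by rewrite addrC; apply: edit_path_trans IH (edit_path1 (edit_sym h)).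
Qed.

Lemma edit_path_ge0 T S c : edit_path T S c -> 0 <= c.
Proof.
elim=> {T S c} // T S A e e' h _ IH; rewrite addr_ge0 //.
case: (editP h) => [[v [y [_ ->]]]|/reduction_ge0|/reduction_ge0] //.
exact: dX_ge0.
Qed.

Lemma single_vertex_iso T S : #|T| = 1%N -> #|S| = 1%N -> dendrogram_iso T S.
Proof.
move=> cT cS.
have eT (x : T) : x = tree_root.
  by apply: fintype_le1P; rewrite cT.
have eS (x : S) : x = tree_root.
  by apply: fintype_le1P; rewrite cS.
exists (fun=> tree_root) => [|x]; last by rewrite (eT x) !weight_root.
split=> [|//|x]; last by rewrite parent_root.
by exists (fun=> tree_root) => x; [rewrite [RHS]eT|rewrite [RHS]eS].
Qed.

(** Deleting all edges makes [dE] finite. *)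
Lemma edit_path_single T : exists S c, #|S| = 1%N /\ edit_path T S c.
Proof.
move En : #|T| => n; elim: n T En => [|n IH] T En.
  by have := fintype0 (tree_root : T); rewrite En.
have [n0|n0] := posnP n.
  exists T, 0; split; first by rewrite En n0.
  exact/edit_path_nil/dendrogram_iso_refl.
have [v vr] : exists v : T, v != tree_root.
  have : (0 < #|predC1 (tree_root : T)|)%N by rewrite cardC1 En.
  by move=> /card_gt0P[v]; exists v.
have kr := remove_vertexP vr.
have rT : reduction T (removed false vr kr) (dX (weight v) 0).
  by exists false, v; split=> //; exact: removedP.
have [|S [c [cS p]]] := IH (removed false vr kr).
  by have := card_tree_remove kr; rewrite En => -[].
exists S, (dX (weight v) 0 + c); split=> //.
by apply: edit_path_cons p; have [] := reduction_edit rT.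
Qed.

Lemma edit_path_exists T S : exists c, edit_path T S c.
Proof.
have [A [a [cA pA]]] := edit_path_single T.
have [B [b [cB pB]]] := edit_path_single S.
exists (a + b); apply: edit_path_trans pA _.
exact: edit_path_iso_l (single_vertex_iso cA cB) (edit_path_sym pB).
Qed.

Local Open Scope ereal_scope.

Lemma dE_le T S c : edit_path T S c -> dE T S <= c%:E.
Proof. by move=> p; apply: ereal_inf_lbound; exists c. Qed.

Lemma le_dE T S (r : \bar R) :
  (forall c, edit_path T S c -> r <= c%:E) -> r <= dE T S.
Proof. by move=> h; apply: le_ereal_inf_tmp => _ [c p <-]; exact: h. Qed.

Lemma dE_ge0 T S : 0 <= dE T S.
Proof. by apply: le_dE => c /edit_path_ge0; rewrite lee_fin. Qed.

Lemma dE_fin_num T S : dE T S \is a fin_num.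
Proof.
have [c /dE_le le_c] := edit_path_exists T S.
by rewrite ge0_fin_numE ?dE_ge0 // (le_lt_trans le_c) // ltry.
Qed.

Lemma dE_sym T S : dE T S = dE S T.
Proof.
by apply/le_anti/andP; split; apply: le_dE => c /edit_path_sym; exact: dE_le.
Qed.

Lemma dE_triangle A T S : dE T S <= dE T A + dE A S.
Proof.
rewrite -leeBlDr ?dE_fin_num //; apply: le_dE => c p.
rewrite leeBlDr ?dE_fin_num // -leeBlDl //; apply: le_dE => c' p'.
by rewrite leeBlDl // -EFinD; exact: dE_le (edit_path_trans p p').
Qed.

Lemma ghost_or_split_path T S :
  clos_refl_trans _ ghost_or_split T S -> edit_path T S 0.
Proof.
elim=> {T S} [T S [[v h]|[v h]]|T|T A S _ p _ q].
- exact/edit_path1/edit_ghost/h.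
- exact/edit_path1/edit_split/h.
- exact/edit_path_nil/dendrogram_iso_refl.
- by rewrite -(addr0 0%R); exact: edit_path_trans p q.
Qed.

Lemma dE_eq0 T S : dE T S = 0 <-> eq_deg2 T S.
Proof.
split=> [d0|[A [B [/ghost_or_split_path pA /ghost_or_split_path pB iso]]]].
  have [e e0 He] := cheap_path_eq_deg2 T S.
  have : ~ e%:E <= dE T S by apply/negP; rewrite d0 -ltNge lte_fin.
  apply: contra_notP => h; apply: le_dE => c p; rewrite lee_fin leNgt.
  by apply/negP => lt_e; apply: h; exact: He p lt_e.
apply/le_anti; rewrite dE_ge0 andbT; apply: dE_le.
rewrite -(addr0 0%R); apply: edit_path_trans pA _.
exact: edit_path_iso_l iso (edit_path_sym pB).
Qed.

(** * The metric on classes *)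

Lemma dE_eq_deg2_l T T' S : eq_deg2 T T' -> dE T S = dE T' S.
Proof.
move/dE_eq0 => d0; apply/le_anti/andP; split.
  by have := dE_triangle T' T S; rewrite d0 add0e.
by have := dE_triangle T T' S; rewrite (dE_sym T' T) d0 add0e.
Qed.

(** That [eq_deg2] is an equivalence relation comes for free from [dE] being a
    pseudometric. *)
Lemma deg2_class_eq T T' : deg2_class T = deg2_class T' <-> eq_deg2 T T'.
Proof.
split=> [/(congr1 (@proj1_sig _ _)) /= ->|h].
  apply/dE_eq0/le_anti; rewrite dE_ge0 andbT; apply: dE_le.
  exact/edit_path_nil/dendrogram_iso_refl.
apply: eq_exist => /=; apply/funext => S; apply/propext; rewrite -!dE_eq0.
by rewrite (dE_eq_deg2_l _ h).
Qed.

Lemma deg2_class_surj (C : dendrogram_deg2 X) : exists T, C = deg2_class T.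
Proof. by case: C => C [T CE]; exists T; exact: eq_exist. Qed.

End Rearrangement.

Theorem corollary3 (R : realType) (X : editableSpace R) :
  (forall T T' : dendrogram X, dE T T' = 0%E <-> eq_deg2 T T') /\
  (exists D : dendrogram_deg2 X -> dendrogram_deg2 X -> R,
     is_metric D /\
     forall T T' : dendrogram X, (D (deg2_class T) (deg2_class T'))%:E = dE T T').
Proof.
split; first exact: dE_eq0.
have [rep repE] := choice (@deg2_class_surj R X).
pose D C C' := fine (dE (rep C) (rep C')).
have DE T T' : (D (deg2_class T) (deg2_class T'))%:E = dE T T'.
  rewrite fineK ?dE_fin_num //.
  have eqrep A : eq_deg2 (rep (deg2_class A)) A.
    by apply/deg2_class_eq; rewrite -repE.
  rewrite (dE_eq_deg2_l _ (eqrep T)) dE_sym.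
  by rewrite (dE_eq_deg2_l _ (eqrep T')) dE_sym.
exists D; split=> //; split.
- by move=> C C'; exact/fine_ge0/dE_ge0.
- move=> C C'; rewrite (repE C) (repE C') deg2_class_eq -dE_eq0 -DE.
  by split=> [->//|[]].
- by move=> C C'; rewrite /D dE_sym.
- move=> A B C; rewrite -lee_fin EFinD !fineK ?dE_fin_num //.
  exact: dE_triangle.
Qed.
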